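(* Let $R$ be a ring, $G$ a finite group acting on $R$, and $H$ a subgroup of $G$. If the skew group ring $RG$ is a left regular coherent ring, then so is $RH$. Moreover, if $RG$ is a separable extension over $RH$, then $RG$ is a left regular coherent ring if and only if $RH$ is a left regular coherent ring.
   Context: Rings are associative with identity. $G$ acts on $R$ by ring automorphisms: $r\mapsto g(r)$ is a ring automorphism for each $g\in G$, $(g_1g_2)(r)=g_1(g_2(r))$ and $1(r)=r$. The skew group ring $RG$ is the free left $R$-module with basis $G$ and multiplication $(ag)(bh)=a\,g(b)\,gh$ for $a,b\in R$, $g,h\in G$. For a subgroup $H\le G$ (with the restricted action), $RH$ is a subring of $RG$. A ring $A$ is a separable extension over a subring $S$ if the multiplication map $A\otimes_S A\to A$, $a\otimes b\mapsto ab$, splits as a map of $A$-$A$-bimodules; i.e. there is $\sum_i a_i\otimes b_i\in A\otimes_S A$ with $\sum_i a_i\otimes b_i a=\sum_i a a_i\otimes b_i$ for all $a\in A$ and $\sum_i a_ib_i=1$. A ring is left regular if every finitely generated left ideal has finite projective dimension (this is not von Neumann regularity). A left regular coherent ring is a left coherent ring that is left regular; for a left coherent ring, left regularity is equivalent to every finitely presented left module having finite projective dimension. *)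

(* Defs.v *)
From HB Require Import structures.
From mathcomp Require Import all_boot all_fingroup all_algebra.

Set Implicit Arguments.
Unset Strict Implicit.
Unset Printing Implicit Defensive.

Import GroupScope GRing.Theory.
Local Open Scope ring_scope.

(** * Actions by ring automorphisms and skew group rings *)

(* The two axioms make every [act g] bijective, with inverse [act g^-1]
   (lemmas [ract_invl] and [ract_invr]), so asking for ring endomorphisms
   is enough.  This is a left action, unlike MathComp's [action]. *)
Record ring_action (gT : finGroupType) (R : pzRingType) := RingAction {
  ract :> gT -> {rmorphism R -> R};
  ract1 : forall r, ract 1%g r = r;
  ractM : forall g h r, ract (g * h)%g r = ract g (ract h r)
}.

Lemma ract_invl (gT : finGroupType) (R : pzRingType) (act : ring_action gT R)
  (g : gT) : cancel (act g) (act g^-1%g).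
Proof. by move=> r; rewrite -ractM mulVg ract1. Qed.

Lemma ract_invr (gT : finGroupType) (R : pzRingType) (act : ring_action gT R)
  (g : gT) : cancel (act g^-1%g) (act g).
Proof. by move=> r; rewrite -ractM mulgV ract1. Qed.

(* The restricted action; the group H is the type [subg_of H]. *)
Section Restriction.
Variables (gT : finGroupType) (R : pzRingType) (act : ring_action gT R).
Variable H : {group gT}.

Fact res_ract1 (r : R) : act (sgval (1%g : subg_of H)) r = r.
Proof. exact: ract1. Qed.

Fact res_ractM (g h : subg_of H) (r : R) :
  act (sgval (g * h)%g) r = act (sgval g) (act (sgval h) r).
Proof. exact: ractM. Qed.

Definition res_ract : ring_action (subg_of H) R :=
  @RingAction _ _ (fun h : subg_of H => act (sgval h)) res_ract1 res_ractM.

End Restriction.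

(* The function x : gT -> R stands for the formal sum of the (x g) g. *)
Definition skew_group_ring (gT : finGroupType) (R : pzRingType)
  (act : ring_action gT R) : Type := {ffun gT -> R}.

Section SkewGroupRing.
Variables (gT : finGroupType) (R : pzRingType) (act : ring_action gT R).
Local Notation RG := (skew_group_ring act).

HB.instance Definition _ := GRing.Zmodule.copy RG {ffun gT -> R}.

Definition skew_coef (x : RG) (g : gT) : R := (x : {ffun gT -> R}) g.

(* [skew_mono a g] is the element a g of RG. *)
Definition skew_mono (a : R) (g : gT) : RG :=
  [ffun h => if h == g then a else 0].

Definition skew_one : RG := skew_mono 1 1%g.

(* The coefficient at k collects the a g(b) with g h = k, i.e. h = g^-1 k. *)
Definition skew_mul (x y : RG) : RG :=
  [ffun k => \sum_(g : gT) skew_coef x g * act g (skew_coef y (g^-1 * k)%g)].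

Lemma skew_coefD x y g : skew_coef (x + y) g = skew_coef x g + skew_coef y g.
Proof. by rewrite /skew_coef ffunE. Qed.

Lemma skew_coefB x y g : skew_coef (x - y) g = skew_coef x g - skew_coef y g.
Proof. by rewrite /skew_coef !ffunE. Qed.

Lemma skew_coef_sum (I : Type) (r : seq I) (P : pred I) (F : I -> RG) g :
  skew_coef (\sum_(i <- r | P i) F i) g = \sum_(i <- r | P i) skew_coef (F i) g.
Proof.
apply: (big_morph (fun x => skew_coef x g)) => [x y|]; first exact: skew_coefD.
by rewrite /skew_coef ffunE.
Qed.

Lemma skew_coef_mono a g h :
  skew_coef (skew_mono a g) h = if h == g then a else 0.
Proof. by rewrite /skew_coef ffunE. Qed.

Lemma skew_coef_mul x y k : skew_coef (skew_mul x y) k =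
  \sum_(g : gT) skew_coef x g * act g (skew_coef y (g^-1 * k)%g).
Proof. by rewrite /skew_coef ffunE. Qed.

Lemma skewP x y : (forall g, skew_coef x g = skew_coef y g) -> x = y.
Proof. by move=> xy; apply/ffunP. Qed.

Fact skew_mulA : associative skew_mul.
Proof.
move=> x y z; apply: skewP => k; rewrite !skew_coef_mul.
under eq_bigr do rewrite skew_coef_mul raddf_sum mulr_sumr.
under [RHS]eq_bigr do rewrite skew_coef_mul mulr_suml.
rewrite [RHS]exchange_big /=; apply: eq_bigr => g _.
rewrite [RHS](reindex_inj (mulgI g)) /=; apply: eq_bigr => h _.
by rewrite mulKg rmorphM ractM invMg !mulrA !mulgA.
Qed.

Fact skew_mul1l : left_id skew_one skew_mul.
Proof.
move=> x; apply: skewP => k; rewrite skew_coef_mul (bigD1 1%g) //= big1.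
  by rewrite skew_coef_mono eqxx mul1r ract1 invg1 mul1g addr0.
by move=> g /negPf g1; rewrite skew_coef_mono g1 mul0r.
Qed.

Fact skew_mul1r : right_id skew_one skew_mul.
Proof.
move=> x; apply: skewP => k; rewrite skew_coef_mul (bigD1 k) //= big1.
  by rewrite skew_coef_mono mulVg eqxx rmorph1 mulr1 addr0.
move=> g gk; rewrite skew_coef_mono -(can_eq (mulKg g)) mulKVg mulg1.
by rewrite eq_sym (negPf gk) rmorph0 mulr0.
Qed.

Fact skew_mulDl : left_distributive skew_mul +%R.
Proof.
move=> x y z; apply: skewP => k; rewrite skew_coefD !skew_coef_mul -big_split.
by apply: eq_bigr => g _ /=; rewrite skew_coefD mulrDl.
Qed.

Fact skew_mulDr : right_distributive skew_mul +%R.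
Proof.
move=> x y z; apply: skewP => k; rewrite skew_coefD !skew_coef_mul -big_split.
by apply: eq_bigr => g _ /=; rewrite skew_coefD rmorphD mulrDr.
Qed.

HB.instance Definition _ := GRing.Zmodule_isPzRing.Build RG
  skew_mulA skew_mul1l skew_mul1r skew_mulDl skew_mulDr.

Lemma skew_coefM (x y : RG) k : skew_coef (x * y) k =
  \sum_(g : gT) skew_coef x g * act g (skew_coef y (g^-1 * k)%g).
Proof. exact: skew_coef_mul. Qed.

Lemma skew_monoM a b g h :
  skew_mono a g * skew_mono b h = skew_mono (a * act g b) (g * h)%g.
Proof.
apply: skewP => k; rewrite skew_coefM (bigD1 g) //= big1 => [|l /negPf lg].
  rewrite !skew_coef_mono eqxx addr0 -(can_eq (mulKg g)) mulKVg.
  by case: eqP; rewrite // rmorph0 mulr0.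
by rewrite skew_coef_mono lg mul0r.
Qed.

Lemma skew_monoE (x : RG) : x = \sum_(g : gT) skew_mono (skew_coef x g) g.
Proof.
apply: skewP => k; rewrite skew_coef_sum (bigD1 k) //= skew_coef_mono eqxx.
by rewrite big1 ?addr0 // => g /negPf gk; rewrite skew_coef_mono eq_sym gk.
Qed.

End SkewGroupRing.

(* The inclusion of RH into RG. *)
Section Inclusion.
Variables (gT : finGroupType) (R : pzRingType) (act : ring_action gT R).
Variable H : {group gT}.
Local Notation RG := (skew_group_ring act).
Local Notation RH := (skew_group_ring (res_ract act H)).

Definition skew_incl (x : RH) : RG :=
  \sum_(h : subg_of H) skew_mono act (skew_coef x h) (sgval h).

Lemma skew_coef_incl (x : RH) (h : subg_of H) :
  skew_coef (skew_incl x) (sgval h) = skew_coef x h.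
Proof.
rewrite skew_coef_sum (bigD1 h) //= skew_coef_mono eqxx big1 ?addr0 // => k.
by move=> /negPf kh; rewrite skew_coef_mono (inj_eq val_inj) eq_sym kh.
Qed.

Lemma skew_coef_incl_out (x : RH) (g : gT) :
  g \notin H -> skew_coef (skew_incl x) g = 0.
Proof.
move=> gH; rewrite skew_coef_sum big1 // => h _; rewrite skew_coef_mono.
by case: eqP gH => [->|] //; rewrite subgP.
Qed.

Lemma skew_incl_inj : injective skew_incl.
Proof. by move=> x y xy; apply: skewP => h; rewrite -!skew_coef_incl xy. Qed.

Fact skew_incl_zmod_morphism : zmod_morphism skew_incl.
Proof.
move=> x y; rewrite /skew_incl -sumrB; apply: eq_bigr => h _.
apply: skewP => g; rewrite [RHS]skew_coefB !skew_coef_mono skew_coefB.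
by case: ifP; rewrite ?subrr.
Qed.

Fact skew_incl_monoid_morphism : monoid_morphism skew_incl.
Proof.
split.
  apply: skewP => g; rewrite skew_coef_mono; case: (boolP (g \in H)) => gH.
    by rewrite -[g](subgK _ gH) skew_coef_incl skew_coef_mono -(inj_eq val_inj).
  by rewrite skew_coef_incl_out //; case: eqP gH => // ->; rewrite group1.
move=> x y; rewrite {2}/skew_incl mulr_suml.
under [RHS]eq_bigr do rewrite /skew_incl mulr_sumr.
apply: skewP => g; rewrite !skew_coef_sum.
under [RHS]eq_bigr => h _.
  rewrite skew_coef_sum (reindex_inj (mulgI h^-1%g)) /=.
  under eq_bigr do rewrite skew_monoM mulKVg skew_coef_mono.
  over.
rewrite exchange_big; apply: eq_bigr => k _ /=; rewrite skew_coef_mono.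
case: ifP => _; last by rewrite big1.
by rewrite skew_coefM.
Qed.

HB.instance Definition _ :=
  GRing.isZmodMorphism.Build RH RG skew_incl skew_incl_zmod_morphism.
HB.instance Definition _ :=
  GRing.isMonoidMorphism.Build RH RG skew_incl skew_incl_monoid_morphism.

End Inclusion.

(** * Separable extensions *)

(* [tensor_eq f s t] says that the sums of the p.1 ⊗ p.2 over s and over t
   are the same element of A ⊗_S A, where A is an S-ring through f.  The
   negative of a ⊗ b is (- a) ⊗ b, so the quotient is a group. *)
Inductive tensor_eq (S A : pzRingType) (f : {rmorphism S -> A}) :
    seq (A * A) -> seq (A * A) -> Prop :=
  | tensor_refl s : tensor_eq f s s
  | tensor_sym s t : tensor_eq f s t -> tensor_eq f t s
  | tensor_trans s t u : tensor_eq f s t -> tensor_eq f t u -> tensor_eq f s u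
  | tensor_perm s t : perm_eq s t -> tensor_eq f s t
  | tensor_cat s s' t t' :
      tensor_eq f s s' -> tensor_eq f t t' -> tensor_eq f (s ++ t) (s' ++ t')
  | tensor_0l b : tensor_eq f [:: (0, b)] [::]
  | tensor_0r a : tensor_eq f [:: (a, 0)] [::]
  | tensor_Dl a a' b : tensor_eq f [:: (a + a', b)] [:: (a, b); (a', b)]
  | tensor_Dr a b b' : tensor_eq f [:: (a, b + b')] [:: (a, b); (a, b')]
  | tensor_bal a c b : tensor_eq f [:: (a * f c, b)] [:: (a, f c * b)].

Definition separable_extension (S A : pzRingType) (f : {rmorphism S -> A}) :=
  exists s : seq (A * A),
    \sum_(p <- s) p.1 * p.2 = 1 /\
    forall a : A,
      tensor_eq f [seq (p.1, p.2 * a) | p <- s] [seq (a * p.1, p.2) | p <- s].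

(** * Finiteness conditions on left modules *)

Section Modules.
Variable A : pzRingType.

Definition surjective (M N : Type) (f : M -> N) := forall y, exists x, f x = y.

Definition exact_at (M N P : lmodType A) (f : {linear M -> N})
  (g : {linear N -> P}) := forall y : N, g y = 0 <-> exists x : M, f x = y.

Definition finitely_generated (M : lmodType A) :=
  exists (n : nat) (f : {linear 'rV[A]_n -> M}), surjective f.

Definition finitely_presented (M : lmodType A) :=
  exists (m n : nat) (g : {linear 'rV[A]_m -> 'rV[A]_n})
         (f : {linear 'rV[A]_n -> M}), exact_at g f /\ surjective f.

Definition projective (P : lmodType A) :=
  forall (M N : lmodType A) (f : {linear M -> N}) (g : {linear P -> N}),
    surjective f -> exists h : {linear P -> M}, forall x, f (h x) = g x.

(* A projective resolution 0 -> P n -> ... -> P 0 -> M -> 0, with P continued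
   by zero modules above n. *)
Definition finite_projective_dimension (M : lmodType A) :=
  exists (n : nat) (P : nat -> lmodType A)
         (d : forall i, {linear P i.+1 -> P i}) (e : {linear P 0%N -> M}),
    [/\ forall i, projective (P i),
        forall i, (n < i)%N -> forall x : P i, x = 0,
        surjective e, exact_at (d 0%N) e
      & forall i, exact_at (d i.+1) (d i)].

(* A left ideal is an I : submodClosed A^o, a submodule of A acting on itself
   by left multiplication; [ideal_module I] is I as a left A-module.
   Membership in I and equality in an [lmodType] are boolean, which is no
   restriction in the presence of excluded middle and choice. *)
Record ideal_module (I : submodClosed A^o) := IdealModule {
  ideal_val : A^o;
  ideal_valP : ideal_val \in I
}.

Section IdealModule.
Variable I : submodClosed A^o.

HB.instance Definition _ := [isSub of ideal_module I for @ideal_val I].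
HB.instance Definition _ := [Choice of ideal_module I by <:].
HB.instance Definition _ := [SubChoice_isSubLmodule of ideal_module I by <:].

End IdealModule.

Definition left_coherent := forall I : submodClosed A^o,
  finitely_generated (ideal_module I) -> finitely_presented (ideal_module I).

Definition left_regular := forall I : submodClosed A^o,
  finitely_generated (ideal_module I) ->
  finite_projective_dimension (ideal_module I).

Definition left_regular_coherent := left_coherent /\ left_regular.

End Modules.

(* Main.v *)
(* Let A = RG, S = RH, and let pi : A -> S restrict coefficients to H.  With t
   ranging over representatives of the right cosets Ht, the families t^-1 and t
   are dual bases of A over S with respect to the S-bimodule map pi, so A/S is a
   Frobenius extension in which S is a bimodule summand: restriction and
   coinduction of modules are both exact and preserve projectives.  Coherence,
   in the form "kernels of matrices are finitely generated", passes both ways by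
   writing the entries in these bases.  For regularity, a finitely generated
   left ideal I of S is a retract of the restriction of A I.  Conversely, a
   finitely generated left ideal J of A is, over S, a finitely generated
   submodule of a free module, hence has finite projective dimension; and
   separability makes J a retract of the coinduction of its restriction. *)
Require Import Defs.
From HB Require Import structures.
From mathcomp Require Import all_boot all_fingroup all_algebra.
From mathcomp Require Import boolp.
Set Implicit Arguments.
Unset Strict Implicit.
Unset Printing Implicit Defensive.
Import GRing.Theory.
Local Open Scope ring_scope.

(** * Projective dimension by syzygies *)

Section Homological.
Variable A : pzRingType.
Implicit Types L M N P Q U V : lmodType A.

Definition lin U V (f : U -> V) (fl : linear f) : {linear U -> V} :=
  HB.pack f (GRing.isLinear.Build A U V *:%R f fl).

(** * Kernels of linear maps as modules *)

Section Kernel.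
Variables (U V : lmodType A) (f : {linear U -> V}).

Definition ker_pred : {pred U} := fun x => f x == 0.

Fact ker_pred_closed : submod_closed ker_pred.
Proof.
split=> [|a x y]; rewrite !unfold_in ?linear0 // => /eqP fx /eqP fy.
by rewrite linearP fx fy scaler0 addr0.
Qed.

HB.instance Definition _ := GRing.isSubmodClosed.Build A U ker_pred ker_pred_closed.

Record ker := Ker { ker_val : U; ker_valP : ker_val \in ker_pred }.

HB.instance Definition _ := [isSub of ker for ker_val].
HB.instance Definition _ := [Choice of ker by <:].
HB.instance Definition _ := [SubChoice_isSubLmodule of ker by <:].

Definition ker_incl : {linear ker -> U} := lin (fun a x y => linearP val a x y).

Lemma ker_inclP x : f (ker_val x) = 0.
Proof. exact/eqP/(ker_valP x). Qed.

Lemma ker_incl_onto x : f x = 0 -> exists y, ker_val y = x.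
Proof. by move/eqP => fx; exists (Ker fx). Qed.

Lemma exact_ker_incl : exact_at ker_incl f.
Proof.
by move=> x; split=> [/ker_incl_onto //|[y <-]]; exact: ker_inclP.
Qed.

Lemma ker_incl_inj : injective ker_incl.
Proof. exact: val_inj. Qed.

End Kernel.

(** Preimages under an injective [i] are unique, so choosing them pointwise already gives a linear
    map. The arrows between syzygies below are built this way. *)
Lemma linear_factor L M U (i : {linear L -> M}) (g : {linear U -> M}) :
  injective i -> (forall u, exists x, i x = g u) ->
  exists h : {linear U -> L}, forall u, i (h u) = g u.
Proof.
move=> i_inj gi.
have gi' u : exists x, i x == g u by have [x xu] := gi u; exists x; rewrite xu.
have hE u : i (xchoose (gi' u)) = g u by exact/eqP/(xchooseP (gi' u)).
have hl : linear (fun u => xchoose (gi' u)).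
  by move=> a u v; apply: i_inj; rewrite hE [LHS]linearP [RHS]linearP !hE.
by exists (lin hl).
Qed.

Definition prod_map U M N (f : {linear U -> M}) (g : {linear U -> N}) :
  {linear U -> (M * N)%type} :=
  @lin U (M * N)%type (fun x => (f x, g x)) (fun a x y =>
    congr2 pair (linearP f a x y) (linearP g a x y)).

Fact sum_map_linear U M N (f : {linear M -> U}) (g : {linear N -> U}) :
  linear (fun x : (M * N)%type => f x.1 + g x.2).
Proof. by move=> a x y; rewrite !linearP scalerDr addrACA. Qed.

Definition sum_map U M N (f : {linear M -> U}) (g : {linear N -> U}) :
  {linear (M * N)%type -> U} := lin (sum_map_linear f g).

Lemma projective0 M : (forall x : M, x = 0) -> projective M.
Proof. by move=> M0 X Y F g _; exists \0 => x; rewrite (M0 x) !linear0. Qed.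

Lemma projective_retract M N (i : {linear M -> N}) (r : {linear N -> M}) :
  cancel i r -> projective N -> projective M.
Proof.
move=> ir prN X Y F g F_surj.
have [h hE] := prN X Y F (g \o r) F_surj.
by exists (h \o i) => x /=; rewrite hE /= ir.
Qed.

Lemma projective_prod M N :
  projective M -> projective N -> projective (M * N)%type.
Proof.
move=> prM prN X Y F g F_surj.
have [h hE] := prM X Y F (g \o prod_map idfun \0) F_surj.
have [k kE] := prN X Y F (g \o prod_map \0 idfun) F_surj.
exists (sum_map h k) => -[x y] /=; rewrite linearD hE kE /= -linearD.
by congr (g _); congr pair; rewrite /= ?addr0 ?add0r.
Qed.

(** Resolutions are peeled off one syzygy at a time, so that statements on projective dimension
    become inductions on [n]. Only some choice of [P] and [K] is asked for. *)
Fixpoint pd_le n M : Prop :=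
  if n is n'.+1 then
    exists (P K : lmodType A) (i : {linear K -> P}) (e : {linear P -> M}),
      [/\ projective P, surjective e, injective i, exact_at i e & pd_le n' K]
  else projective M.

Lemma pd_leS n M : pd_le n M -> pd_le n.+1 M.
Proof.
elim: n M => [|n IHn] M.
  move=> prM; exists M, (ker (idfun : {linear M -> M})), (ker_incl _), idfun.
  split=> //; first by move=> x; exists x.
  - exact: ker_incl_inj.
  - exact: exact_ker_incl.
  apply: projective0 => x; apply: ker_incl_inj.
  by rewrite linear0; exact: (ker_inclP x).
move=> [P [K [i [e [prP e_surj i_inj ex pdK]]]]].
by exists P, K, i, e; split=> //; exact: IHn.
Qed.

Lemma pd_le_trans m n M : (m <= n)%N -> pd_le m M -> pd_le n M.
Proof.
move=> /subnK <-; elim: (n - m)%N => // k IHk /IHk; exact: pd_leS.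
Qed.

(** The horseshoe lemma: projectives over [L] and [N] add up to one over [M], and the three syzygies
    again form an extension. For [n = 0] the sequence splits. *)
Lemma pd_le_extension n L M N (i : {linear L -> M}) (e : {linear M -> N}) :
  injective i -> surjective e -> exact_at i e ->
  pd_le n L -> pd_le n N -> pd_le n M.
Proof.
elim: n L M N i e => [|n IHn] L M N i e i_inj e_surj ex.
  move=> prL prN; have [s sE] := prN M N e idfun e_surj.
  have [|h /= hE] := @linear_factor L M M i (idfun \- (s \o e)) i_inj.
    by move=> x; apply/ex; rewrite /= linearB sE subrr.
  apply: (@projective_retract M _ (prod_map h e) (sum_map i s)).
    by move=> x; rewrite /= hE /= subrK.
  exact: projective_prod.
move=> [P1 [K1 [i1 [e1 [prP1 e1_surj i1_inj ex1 pdK1]]]]].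
move=> [P2 [K2 [i2 [e2 [prP2 e2_surj i2_inj ex2 pdK2]]]]].
have [s sE] := prP2 M N e e2 e_surj.
pose E := sum_map (i \o e1) s.
have eE z : e (E z) = e2 z.2.
  by rewrite linearD sE (_ : e _ = 0) ?add0r //; apply/ex; exists (e1 z.1).
exists (P1 * P2)%type, (ker E), (ker_incl E), E; split.
- exact: projective_prod.
- move=> x; have [q qE] := e2_surj (e x).
  have /ex [l lE] : e (x - s q) = 0 by rewrite linearB sE qE subrr.
  by have [p pE] := e1_surj l; exists (p, q); rewrite /= pE lE subrK.
- exact: ker_incl_inj.
- exact: exact_ker_incl.
(* The maps [d] and [c] form the sequence of syzygies 0 -> K1 -> ker E -> K2 -> 0. *)
have [|c /= cE] := @linear_factor K2 P2 (ker E) i2 (snd \o ker_incl E) i2_inj.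
  by move=> z; apply/ex2; rewrite /= -eE ker_inclP linear0.
have [|d /= dE] :=
    @linear_factor (ker E) _ K1 (ker_incl E) (prod_map i1 \0) (@ker_incl_inj _ _ E).
  move=> k; apply: ker_incl_onto; rewrite /= linear0 addr0.
  by rewrite (_ : e1 _ = 0) ?linear0 //; apply/ex1; exists k.
apply: (IHn K1 (ker E) K2 d c) => //.
- by move=> k k' /(congr1 (@ker_val _ _ _)); rewrite !dE => -[/i1_inj].
- move=> k; have /ex [l lE] : e (s (i2 k)) = 0.
    by rewrite sE; apply/ex2; exists k.
  have [p pE] := e1_surj l.
  (* To lift [k] to [ker E], the first component cancels [s (i2 k)], which lies in the image of
     [i]. *)
  have [|z /= zE] := @ker_incl_onto _ _ E (- p, i2 k).
    by rewrite /= !linearN pE lE addNr.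
  by exists z; apply: i2_inj; rewrite /= cE zE.
move=> z; split=> [cz0|[k <-]]; last first.
  by apply: i2_inj; rewrite /= cE dE linear0.
have z2 : (ker_val z).2 = 0 by rewrite -[LHS]cE cz0 linear0.
have : E (ker_val z) = 0 by exact: ker_inclP.
rewrite /= z2 linear0 addr0 => iez.
have /ex1 [k kE] : e1 (ker_val z).1 = 0 by apply: i_inj; rewrite iez linear0.
exists k; apply: ker_incl_inj; rewrite /= dE kE -z2.
exact/esym/surjective_pairing.
Qed.

(** If [K] is the syzygy of [N] in [P], then [r \o e] maps the same [P] onto [M], and its kernel is
    a retract of [K * P], in the manner of Schanuel. The induction goes on because [K * P] has
    dimension at most [n]. *)
Lemma pd_le_retract n M N (i : {linear M -> N}) (r : {linear N -> M}) :
  cancel i r -> pd_le n N -> pd_le n M.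
Proof.
elim: n M N i r => [|n IHn] M N i r ir; first exact: projective_retract.
move=> [P [K [j [e [prP e_surj j_inj ex pdK]]]]].
(* [t] lifts the idempotent [i \o r] to [P]. It sends the kernel of [p] into [K], while [idfun \- t]
   sends [P] into the kernel of [p]. *)
have [t tE] := prP P N e (i \o r \o e) e_surj.
pose p := r \o e : {linear P -> M}.
exists P, (ker p), (ker_incl p), p; split=> //.
- by move=> x; have [y yE] := e_surj (i x); exists y; rewrite /= yE ir.
- exact: ker_incl_inj.
- exact: exact_ker_incl.
have pdKP : pd_le n (K * P)%type.
  apply: (@pd_le_extension n K _ P (prod_map idfun \0) snd) => //.
  - by move=> x y [].
  - by move=> y; exists (0, y).
  - by move=> [x y] /=; split=> [->|[k [_ <-]] //]; exists x.
  exact: (@pd_le_trans 0).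
have [|u /= uE] := @linear_factor K P (ker p) j (t \o ker_incl p) j_inj.
  move=> x; apply/ex; rewrite /= tE /=.
  by have /= -> := ker_inclP x; rewrite linear0.
have [|v /= vE] := @linear_factor (ker p) P _ (ker_incl p) (sum_map j (idfun \- t))
    (@ker_incl_inj _ _ p).
  move=> z; apply: ker_incl_onto => /=.
  rewrite !linearD !linearN /= tE /= ir subrr addr0.
  by rewrite (_ : e _ = 0) ?linear0 //; apply/ex; exists z.1.
apply: (IHn _ _ (prod_map u (ker_incl p)) v) => // x.
by apply: ker_incl_inj; rewrite /= vE uE addrC subrK.
Qed.

Lemma finite_pdP M :
  finite_projective_dimension M <-> exists n, pd_le n M.
Proof.
split=> [[n [P [d [e [prP P0 e_surj exe exd]]]]]|[n]].
  exists n; elim: n M P d e prP P0 e_surj exe exd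
    => [|n IHn] M P d e prP P0 e_surj exe exd.
    (* In length 0 the module [P 1] vanishes, so [e] is an isomorphism. *)
    have e_inj : injective e.
      move=> x y exy; apply/eqP; rewrite -subr_eq0; apply/eqP.
      have /exe [z <-] : e (x - y) = 0 by rewrite linearB exy subrr.
      by rewrite (P0 1%N isT z) linear0.
    have [//|h /= hE] := @linear_factor (P 0%N) M M e idfun e_inj.
    by apply: (@projective_retract M (P 0%N) h e).
  exists (P 0%N), (ker e), (ker_incl e), e; split=> //.
  - exact: ker_incl_inj.
  - exact: exact_ker_incl.
  have [|e' /= e'E] := @linear_factor (ker e) _ _ (ker_incl e) (d 0%N) (@ker_incl_inj _ _ e).
    by move=> x; apply: ker_incl_onto; apply/exe; exists x.
  apply: (IHn _ (fun i => P i.+1) (fun i => d i.+1) e') => //.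
  - by move=> i ni; exact: P0.
  - move=> k; have /exe [x xE] := ker_inclP k.
    by exists x; apply: ker_incl_inj; rewrite /= e'E.
  move=> x; rewrite -(exd 0%N x) -e'E; split=> [->|e'0] //.
  by apply: ker_incl_inj; rewrite /= e'0.
elim: n M => [|n IHn] M /=.
  move=> prM; exists 0%N, (fun i => if i is 0%N then M else 'rV[A]_0).
  pose d i :
      {linear 'rV[A]_0 -> (if i is 0%N then M else 'rV[A]_0) : lmodType A} :=
    match i with 0%N => \0 | _ => \0 end.
  exists d, idfun; split=> //.
  - case=> // i; apply: projective0 => x; exact: thinmx0.
  - case=> // i _ x; exact: thinmx0.
  - by move=> x; exists x.
  - by move=> x; split=> /= [->|[y <-] //]; exists 0.
  by move=> i x; split=> _; [exists 0|]; rewrite !thinmx0 //; case: i x.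
move=> [P [K [j [e [prP e_surj j_inj ex /IHn]]]]].
move=> [m [P' [d' [e' [prP' P'0 e'_surj ex' exd']]]]].
(* Splicing: the resolution of [K] moves up one degree, and [j \o e'] becomes the first
   differential. *)
exists m.+1, (fun i => if i is i'.+1 then P' i' else P).
pose d i : {linear P' i -> (if i is i'.+1 then P' i' else P) : lmodType A} :=
  match i with 0%N => j \o e' | i'.+1 => d' i' end.
exists d, e; split=> //.
- by case.
- by case=> // i im; exact: P'0.
- move=> x; rewrite (ex x); split=> [[k <-]|[y <-]].
    by have [y <-] := e'_surj k; exists y.
  by exists (e' y).
case=> [x|i]; last exact: exd'.
rewrite -(ex' x) /=; split=> [|->]; last by rewrite linear0.
by rewrite -(linear0 j) => /j_inj.
Qed.

End Homological.
(** * Coherence and syzygies of matrices *)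

Section Coherence.
Variable A : pzRingType.
Implicit Types M V : lmodType A.

Definition spans (I : finType) V (m : I -> V) :=
  forall x, exists c : I -> A, x = \sum_i c i *: m i.

(* The rows of W generate the module of the x with x m = 0. *)
Definition syzygies (I J K : finType) V (m : I -> J -> V) (W : K -> I -> A) :=
  (forall k j, \sum_i W k i *: m i j = 0) /\
  forall x : I -> A, (forall j, \sum_i x i *: m i j = 0) ->
    exists y : K -> A, forall i, x i = \sum_k y k * W k i.

(** Any number of columns is allowed, which makes the condition stable under a change of rings,
    where one column becomes several. *)
Definition coherent_matrices := forall (I J : finType) (m : I -> J -> A^o),
  exists (K : finType) (W : K -> I -> A), syzygies m W.

Lemma exchange_scale_sum (I K : finType) V (y : K -> A) (W : K -> I -> A)
    (m : I -> V) :
  \sum_i (\sum_k y k * W k i) *: m i = \sum_k y k *: \sum_i W k i *: m i.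
Proof.
under eq_bigr do rewrite scaler_suml.
rewrite exchange_big; apply: eq_bigr => k _; rewrite scaler_sumr.
by apply: eq_bigr => i _; rewrite scalerA.
Qed.

Lemma sum_kronecker (I : finType) V (m : I -> V) i :
  \sum_j (i == j)%:R *: m j = m i.
Proof.
rewrite (bigD1 i) //= eqxx scale1r big1 ?addr0 // => j.
by rewrite eq_sym => /negPf ->; rewrite scale0r.
Qed.

Fact row_comb_linear (I : finType) V (m : I -> V) :
  linear (fun r : 'rV[A]_#|I| => \sum_i r 0 (enum_rank i) *: m i).
Proof.
move=> a r s; rewrite scaler_sumr -big_split; apply: eq_bigr => i _.
by rewrite !mxE scalerDl scalerA.
Qed.

Definition row_comb (I : finType) V (m : I -> V) : {linear 'rV[A]_#|I| -> V} :=
  lin (row_comb_linear m).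

Lemma row_combE (I : finType) V (m : I -> V) (c : I -> A) :
  row_comb m (\row_j c (enum_val j)) = \sum_i c i *: m i.
Proof. by apply: eq_bigr => i _; rewrite mxE enum_rankK. Qed.

Lemma linear_rowE n V (f : {linear 'rV[A]_n -> V}) r :
  f r = \sum_i r 0 i *: f (delta_mx 0 i).
Proof. by rewrite {1}[r]row_sum_delta linear_sum; under eq_bigr do rewrite linearZ. Qed.

Lemma finitely_generatedP M :
  finitely_generated M <-> exists (I : finType) (m : I -> M), spans m.
Proof.
split=> [[n [f f_surj]]|[I [m m_span]]].
  exists 'I_n, (fun i => f (delta_mx 0 i)) => x; have [r <-] := f_surj x.
  by exists (r 0); exact: linear_rowE.
exists #|I|, (row_comb m) => x; have [c ->] := m_span x.
by exists (\row_j c (enum_val j)); exact: row_combE.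
Qed.

(** Finite generation of the relations does not depend on the chosen generators. *)
Lemma finitely_presented_syzygies M (I : finType) (m : I -> M) :
  finitely_presented M -> spans m ->
  exists (K : finType) (W : K -> I -> A), syzygies (fun i (_ : unit) => m i) W.
Proof.
move=> [p [n [g [f [exf f_surj]]]]] m_span.
have /fin_all_exists [q qE] i : exists r : 'rV_n, f r = m i by exact: f_surj.
have /fin_all_exists [P PE] (j : 'I_n) := m_span (f (delta_mx 0 j)).
have PfE (r : 'rV_n) : \sum_i (\sum_j r 0 j * P j i) *: m i = f r.
  rewrite exchange_scale_sum linear_rowE.
  by apply: eq_bigr => j _; rewrite PE.
(* A relation x is the sum of the x_i (e_i - q_i P) plus (x q) P. The first rows of [W] are the e_i
   - q_i P; the others come from the relations [g], which generate the kernel of [f], where x q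
   lies. *)
pose W (k : I + 'I_p) i := match k with
  | inl i' => (i' == i)%:R - \sum_j q i' 0 j * P j i
  | inr l => \sum_j g (delta_mx 0 l) 0 j * P j i end.
exists (I + 'I_p)%type, W; split.
  move=> [i'|l] _ /=; last by rewrite PfE; apply/exf; exists (delta_mx 0 l).
  under eq_bigr do rewrite scalerBl.
  by rewrite sumrB PfE sum_kronecker qE subrr.
move=> x /(_ tt) x0; have /exf [z zE] : f (\sum_i x i *: q i) = 0.
  by rewrite linear_sum -[RHS]x0; apply: eq_bigr => i _; rewrite linearZ /= qE.
exists (fun k => match k with inl i' => x i' | inr l => z 0 l end) => i.
rewrite big_sumType /=; under eq_bigr do rewrite mulrBr.
rewrite sumrB -[LHS]addr0 -addrA; congr (_ + _).
  rewrite (bigD1 i) //= eqxx mulr1 big1 ?addr0 // => j /negPf ->.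
  by rewrite mulr0.
apply/esym/eqP; rewrite addrC subr_eq0; apply/eqP.
transitivity (\sum_j (\sum_l z 0 l *: g (delta_mx 0 l)) 0 j * P j i).
  under [RHS]eq_bigr do rewrite summxE mulr_suml.
  rewrite exchange_big; apply: eq_bigr => l _; rewrite mulr_sumr.
  by apply: eq_bigr => j _; rewrite mxE mulrA.
rewrite -linear_rowE zE.
under eq_bigr do rewrite summxE mulr_suml.
rewrite exchange_big; apply: eq_bigr => i' _; rewrite mulr_sumr.
by apply: eq_bigr => j _; rewrite mxE mulrA.
Qed.

Lemma syzygies_finitely_presented M (I K : finType) (m : I -> M)
    (W : K -> I -> A) :
  spans m -> syzygies (fun i (_ : unit) => m i) W -> finitely_presented M.
Proof.
move=> m_span [W0 WP]; pose w k : 'rV[A]_#|I| := \row_j W k (enum_val j).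
exists #|K|, #|I|, (row_comb w), (row_comb m); split.
  move=> r; split=> [r0|[s <-]].
    have [_|y yE] := WP (fun i => r 0 (enum_rank i)); first exact: r0.
    exists (\row_j y (enum_val j)); rewrite row_combE.
    apply/rowP => j; rewrite summxE -[j]enum_valK yE.
    by apply: eq_bigr => k _; rewrite !mxE enum_rankK.
  rewrite (linear_sum (row_comb m)) big1 // => k _.
  by rewrite linearZZ row_combE (W0 k tt) scaler0.
move=> x; have [c ->] := m_span x.
by exists (\row_j c (enum_val j)); exact: row_combE.
Qed.

(** * Images of linear forms as left ideals *)

Section ImageIdeal.
Variables (V : lmodType A) (f : {linear V -> A^o}).

Definition image_pred : {pred A^o} := fun a => `[< exists x, f x = a >].

Fact image_pred_closed : submod_closed image_pred.
Proof.
split=> [|a _ _ /asboolP [x <-] /asboolP [y <-]]; apply/asboolP.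
  by exists 0; rewrite linear0.
by exists (a *: x + y); rewrite linearP.
Qed.

HB.instance Definition _ :=
  GRing.isSubmodClosed.Build A A^o image_pred image_pred_closed.

Definition image_ideal : submodClosed A^o := image_pred.

Fact image_proj_subproof x : f x \in image_pred.
Proof. by apply/asboolP; exists x. Qed.

Fact image_proj_linear :
  linear (fun x => IdealModule (image_proj_subproof x) : ideal_module image_ideal).
Proof. by move=> a x y; apply: val_inj; rewrite /= linearP. Qed.

Definition image_proj : {linear V -> ideal_module image_ideal} :=
  lin image_proj_linear.

Lemma image_proj_surj : surjective image_proj.
Proof. by case=> a aI; have /asboolP [x xa] := aI; exists x; apply: val_inj. Qed.

End ImageIdeal.

Lemma surjective_spans V M (f : {linear V -> M}) (I : finType) (m : I -> V) :
  surjective f -> spans m -> spans (f \o m).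
Proof.
move=> f_surj m_span x; have [y <-] := f_surj x; have [c ->] := m_span y.
by exists c; rewrite linear_sum; apply: eq_bigr => i _; rewrite linearZ.
Qed.

(** The entries of [v] generate a left ideal, whose finite presentation yields the relations between
    them. *)
Lemma left_coherent_columns (I : finType) (v : I -> A^o) : left_coherent A ->
  exists (K : finType) (W : K -> I -> A), syzygies (fun i (_ : unit) => v i) W.
Proof.
move=> cohA; pose f := row_comb v; pose p := image_proj f.
have p_span : spans (fun i => p (\row_j (i == enum_val j)%:R)).
  move=> x; have [r <-] := image_proj_surj x.
  exists (fun i => r 0 (enum_rank i)).
  rewrite (eq_bigr (fun i => p (r 0 (enum_rank i) *: \row_j (i == enum_val j)%:R))).
    rewrite -linear_sum; congr (p _); apply/rowP => j; rewrite summxE.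
    rewrite (bigD1 (enum_val j)) //= big1 => [|i /negPf ij]; rewrite !mxE.
      by rewrite eqxx mulr1 addr0 enum_valK.
    by rewrite ij mulr0.
  by move=> i _; rewrite linearZ.
have [|K [W [W0 WP]]] := finitely_presented_syzygies _ p_span.
  apply: cohA; apply/finitely_generatedP; exists I; eexists; exact: p_span.
have valE x : ideal_val (\sum_i x i *: p (\row_j (i == enum_val j)%:R)) =
    \sum_i x i *: v i.
  rewrite -[LHS]/(val _) linear_sum; apply: eq_bigr => i _; rewrite linearZ /=.
  congr (_ * _); rewrite -(sum_kronecker v i).
  exact: row_combE v (fun j => (i == j)%:R).
exists K, W; split=> [k j|x x0]; first by rewrite -valE (W0 k j).
by apply: WP => j; apply: val_inj; rewrite /= valE x0.
Qed.

Lemma left_coherentP : left_coherent A <-> coherent_matrices.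
Proof.
split=> [cohA I J m|cohA I /finitely_generatedP [K [m m_span]]]; last first.
  have [L [W [W0 WP]]] := cohA K unit (fun k _ => val (m k)).
  have valE x : val (\sum_k x k *: m k) = \sum_k x k *: val (m k).
    by rewrite linear_sum; apply: eq_bigr => k _; rewrite linearZ.
  apply: (@syzygies_finitely_presented _ K L m W) => //.
  split=> [l j|x x0]; first by apply: val_inj; rewrite valE W0.
  by apply: WP => j; rewrite -valE x0.
suff [K [W [W0 WP]]] : exists (K : finType) (W : K -> I -> A),
    (forall k j, j \in enum J -> \sum_i W k i *: m i j = 0) /\
    forall x : I -> A, (forall j, j \in enum J -> \sum_i x i *: m i j = 0) ->
      exists y : K -> A, forall i, x i = \sum_k y k * W k i.
  exists K, W; split=> [k j|x x0]; first by rewrite W0 ?mem_enum.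
  by apply: WP => j _.
elim: (enum J) => [|j s [K [W [W0 WP]]]].
  exists I, (fun i j => (i == j)%:R); split=> // x _; exists x => i.
  rewrite (bigD1 i) //= eqxx mulr1 big1 ?addr0 // => j /negPf ->.
  by rewrite mulr0.
(* [W] generates the syzygies of the columns in [s]; [U] generates the combinations of its rows that
   also kill column [j]. So [U] times [W] serves [j :: s]. *)
have [L [U [U0 UP]]] :=
  left_coherent_columns (fun k => \sum_i W k i *: m i j) cohA.
exists L, (fun l i => \sum_k U l k * W k i); split=> [l j'|x x0].
  rewrite inE exchange_scale_sum => /predU1P [->|j's]; first exact: (U0 l tt).
  by rewrite big1 // => k _; rewrite W0 ?scaler0.
have [j' j's|y yE] := WP x; first by rewrite x0 // inE j's orbT.
have [_|z zE] := UP y.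
  rewrite -exchange_scale_sum -[RHS](x0 j) ?mem_head //.
  by apply: eq_bigr => i _; rewrite yE.
exists z => i; rewrite yE; under eq_bigr do rewrite zE mulr_suml.
rewrite exchange_big; apply: eq_bigr => l _; rewrite mulr_sumr.
by apply: eq_bigr => k _; rewrite mulrA.
Qed.

(* Filter the free module by its coordinates: the image of a coordinate is a
   finitely generated ideal, and by coherence its kernel is again finitely
   generated. *)
Lemma pd_finite_of_coordinates N M (c : 'I_N -> {linear M -> A^o}) :
  left_regular_coherent A -> finitely_generated M ->
  (forall x, (forall i, c i x = 0) -> x = 0) -> exists n, pd_le n M.
Proof.
move=> [/left_coherentP cohA regA].
elim: N M c => [|N IHN] M c /finitely_generatedP [I [m m_span]] c_inj.
  by exists 0%N; apply: projective0 => x; apply: c_inj; case.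
pose p := image_proj (c ord0).
have [|q pdI] := (finite_pdP (ideal_module (image_ideal (c ord0)))).1.
  apply: regA; apply/finitely_generatedP; exists I, (p \o m).
  exact: surjective_spans (@image_proj_surj _ _) m_span.
have [|x|r pdK] := IHN (ker (c ord0)) (fun i => c (lift ord0 i) \o ker_incl _).
- have [K [W [W0 WP]]] := cohA I unit (fun i _ => c ord0 (m i)).
  have combE x : c ord0 (\sum_i x i *: m i) = \sum_i x i *: c ord0 (m i).
    by rewrite linear_sum; apply: eq_bigr => i _; rewrite linearZ.
  have /fin_all_exists [w wE] k : exists z : ker (c ord0),
      ker_val z = \sum_i W k i *: m i.
    by apply: ker_incl_onto; rewrite combE (W0 k tt).
  apply/finitely_generatedP; exists K, w => z.
  have [x xE] := m_span (ker_val z).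
  have [_|y yE] := WP x; first by rewrite -combE -xE ker_inclP.
  exists y; apply: val_inj; rewrite /= xE.
  under [LHS]eq_bigr do rewrite yE.
  rewrite exchange_scale_sum -[RHS]/(val _) linear_sum.
  by apply: eq_bigr => k _; rewrite linearZ /= wE.
- move=> x0; apply: val_inj; apply: c_inj => i /=.
  by case: (unliftP ord0 i) => [j ->|->]; [exact: x0|exact: ker_inclP].
exists (maxn q r).
apply: (@pd_le_extension A _ (ker (c ord0)) M _ (ker_incl _) p).
- exact: ker_incl_inj.
- exact: image_proj_surj.
- move=> x; rewrite -(exact_ker_incl (c ord0) x).
  by split=> [/(congr1 val)|cx] //; apply: val_inj.
- exact: pd_le_trans (leq_maxr _ _) pdK.
exact: pd_le_trans (leq_maxl _ _) pdI.
Qed.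

End Coherence.
(** * Split Frobenius extensions *)

(** A separate name for [M] that mentions [f], so that the type itself determines the scalars acting
    on it. *)
Definition res_mod (S A : pzRingType) (f : {rmorphism S -> A})
  (M : lmodType A) : Type := M.

Section Restriction.
Variables (S A : pzRingType) (f : {rmorphism S -> A}).

Section ResMod.
Variable M : lmodType A.

HB.instance Definition _ := GRing.Zmodule.copy (res_mod f M) M.

Definition res_scale (s : S) (x : res_mod f M) : res_mod f M := f s *: (x : M).

Fact res_scalerA s t x : res_scale s (res_scale t x) = res_scale (s * t) x.
Proof. by rewrite /res_scale scalerA rmorphM. Qed.

Fact res_scale1r : left_id 1 res_scale.
Proof. by move=> x; rewrite /res_scale rmorph1 scale1r. Qed.

Fact res_scalerDr : right_distributive res_scale +%R.
Proof. by move=> s x y; exact: scalerDr. Qed.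

Fact res_scalerDl x : {morph res_scale^~ x : s t / s + t}.
Proof. by move=> s t; rewrite /res_scale rmorphD; exact: scalerDl. Qed.

HB.instance Definition _ := GRing.Zmodule_isLmodule.Build S (res_mod f M)
  res_scalerA res_scale1r res_scalerDr res_scalerDl.

End ResMod.

Lemma res_scaleE (M : lmodType A) s (x : res_mod f M) : s *: x = f s *: (x : M).
Proof. by []. Qed.

Fact res_lin_linear (M N : lmodType A) (u : {linear M -> N}) :
  linear (u : res_mod f M -> res_mod f N).
Proof. by move=> s x y; exact: linearP. Qed.

Definition res_lin (M N : lmodType A) (u : {linear M -> N}) :
  {linear res_mod f M -> res_mod f N} := lin (res_lin_linear u).

End Restriction.

(* A split Frobenius extension with orthonormal dual bases: A is free over S on
   both sides, with bases frob_x and frob_y dual for the S-bimodule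
   projection frob_pi. *)
Record frobenius (S A : pzRingType) (f : {rmorphism S -> A}) := Frobenius {
  frob_idx : finType;
  frob_pi : {additive A -> S};
  frob_x : frob_idx -> A;
  frob_y : frob_idx -> A;
  frob_piMl : forall s a, frob_pi (f s * a) = s * frob_pi a;
  frob_piMr : forall a s, frob_pi (a * f s) = frob_pi a * s;
  frob_pi1 : frob_pi 1 = 1;
  frob_xE : forall a, a = \sum_i frob_x i * f (frob_pi (frob_y i * a));
  frob_yE : forall a, a = \sum_i f (frob_pi (a * frob_x i)) * frob_y i;
  frob_dual : forall i j, frob_pi (frob_y i * frob_x j) = (i == j)%:R
}.

(* [coind_mod F M] is Hom_S(A, M), a map phi being stored as the family of the
   phi (y i); the left action (a phi)(z) = phi (z a) becomes that of the matrix
   pi (y i * a * x j). *)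
Definition coind_mod (S A : pzRingType) (f : {rmorphism S -> A}) (F : frobenius f)
  (M : lmodType S) : Type := {ffun frob_idx F -> M}.

Section Coinduction.
Variables (S A : pzRingType) (f : {rmorphism S -> A}) (F : frobenius f).
Local Notation T := (frob_idx F).
Local Notation pi := (frob_pi F).
Local Notation x_ := (@frob_x _ _ f F).
Local Notation y_ := (@frob_y _ _ f F).

Lemma frob_pif s : pi (f s) = s.
Proof. by rewrite -[f s]mulr1 frob_piMl frob_pi1 mulr1. Qed.

(** Obtained by expanding [b] in the basis [x_]. It makes a |-> (pi (y i * a * x j)) multiplicative,
    hence an action on coinduced modules. *)
Lemma frob_piM a b : pi (a * b) = \sum_i pi (a * x_ i) * pi (y_ i * b).
Proof.
rewrite {1}[b](frob_xE F) mulr_sumr raddf_sum.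
by apply: eq_bigr => i _; rewrite mulrA frob_piMr.
Qed.

Section CoindMod.
Variable M : lmodType S.
Local Notation coind := (coind_mod F M).

HB.instance Definition _ := GRing.Zmodule.copy coind {ffun T -> M}.

Definition coind_at (m : coind) i : M := (m : {ffun T -> M}) i.

Definition coind_of (m : T -> M) : coind := [ffun i => m i].

Lemma coind_atE m i : coind_at (coind_of m) i = m i.
Proof. exact: ffunE. Qed.

Lemma coind_atP m n : (forall i, coind_at m i = coind_at n i) -> m = n.
Proof. by move=> mn; apply/ffunP. Qed.

Lemma coind_atD m n i : coind_at (m + n) i = coind_at m i + coind_at n i.
Proof. exact: ffunE. Qed.

Lemma coind_at_sum (I : finType) (m : I -> coind) i :
  coind_at (\sum_k m k) i = \sum_k coind_at (m k) i.
Proof. exact: sum_ffunE. Qed.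

Definition coind_scale (a : A) (m : coind) : coind :=
  coind_of (fun i => \sum_j pi (y_ i * a * x_ j) *: coind_at m j).

Fact coind_scalerA a b m :
  coind_scale a (coind_scale b m) = coind_scale (a * b) m.
Proof.
apply: coind_atP => i; rewrite !coind_atE.
under eq_bigr do rewrite coind_atE.
rewrite -exchange_scale_sum; apply: eq_bigr => j _; congr (_ *: _).
rewrite -2!mulrA mulrA frob_piM.
by apply: eq_bigr => k _; rewrite !mulrA.
Qed.

Fact coind_scale1r : left_id 1 coind_scale.
Proof.
move=> m; apply: coind_atP => i; rewrite coind_atE.
under eq_bigr do rewrite mulr1 frob_dual.
exact: sum_kronecker.
Qed.

Fact coind_scalerDr : right_distributive coind_scale +%R.
Proof.
move=> a m n; apply: coind_atP => i; rewrite coind_atD !coind_atE -big_split.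
by apply: eq_bigr => j _; rewrite coind_atD scalerDr.
Qed.

Fact coind_scalerDl m : {morph coind_scale^~ m : a b / a + b}.
Proof.
move=> a b; apply: coind_atP => i; rewrite coind_atD !coind_atE -big_split.
by apply: eq_bigr => j _; rewrite mulrDr mulrDl raddfD scalerDl.
Qed.

HB.instance Definition _ := GRing.Zmodule_isLmodule.Build A coind
  coind_scalerA coind_scale1r coind_scalerDr coind_scalerDl.

Lemma coind_scaleE a (m : coind) i :
  coind_at (a *: m) i = \sum_j pi (y_ i * a * x_ j) *: coind_at m j.
Proof. exact: coind_atE. Qed.

End CoindMod.

Fact coind_lin_linear (M N : lmodType S) (u : {linear M -> N}) :
  linear (fun m : coind_mod F M => coind_of (u \o coind_at m)).
Proof.
move=> a m n; apply: coind_atP => i.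
rewrite coind_atD coind_scaleE !coind_atE /= coind_atD coind_scaleE.
rewrite linearD linear_sum; congr (_ + _); apply: eq_bigr => j _.
by rewrite linearZ coind_atE.
Qed.

Definition coind_lin (M N : lmodType S) (u : {linear M -> N}) :
  {linear coind_mod F M -> coind_mod F N} := lin (coind_lin_linear u).

Lemma coind_linE (M N : lmodType S) (u : {linear M -> N}) m i :
  coind_at (coind_lin u m) i = u (coind_at m i).
Proof. exact: coind_atE. Qed.

Lemma coind_surj (M N : lmodType S) (u : {linear M -> N}) :
  surjective u -> surjective (coind_lin u).
Proof.
move=> u_surj n; have /fin_all_exists [m mE] i := u_surj (coind_at n i).
by exists (coind_of m); apply: coind_atP => i; rewrite coind_linE coind_atE.
Qed.

Lemma coind_inj (M N : lmodType S) (u : {linear M -> N}) :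
  injective u -> injective (coind_lin u).
Proof.
move=> u_inj m n mn; apply: coind_atP => i; apply: u_inj.
by rewrite -!coind_linE mn.
Qed.

Lemma coind_exact (M N P : lmodType S) (u : {linear M -> N})
  (v : {linear N -> P}) : exact_at u v -> exact_at (coind_lin u) (coind_lin v).
Proof.
have at0 (Q : lmodType S) i : coind_at (0 : coind_mod F Q) i = 0.
  exact: ffunE.
move=> ex n; split=> [n0|[m <-]]; last first.
  apply: coind_atP => i; rewrite !coind_linE at0.
  by apply/ex; exists (coind_at m i).
have ni i : exists m, u m = coind_at n i.
  by apply/ex; rewrite -coind_linE n0 at0.
have /fin_all_exists [m mE] := ni.
by exists (coind_of m); apply: coind_atP => i; rewrite coind_linE coind_atE.
Qed.

(* The two adjunctions: restriction is left adjoint to coinduction, and, A being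
   Frobenius over S, also right adjoint to it. *)
Fact res_to_coind_linear (M : lmodType A) (N : lmodType S)
    (u : {linear res_mod f M -> N}) :
  linear (fun x : M => coind_of (fun i => u (y_ i *: x))).
Proof.
move=> a x y; apply: coind_atP => i.
rewrite coind_atD coind_scaleE !coind_atE scalerDr [LHS]linearD.
congr (_ + _); rewrite scalerA {1}[y_ i * a](frob_yE F) scaler_suml.
rewrite [LHS]linear_sum; apply: eq_bigr => j _.
by rewrite coind_atE -scalerA -res_scaleE [LHS]linearZ.
Qed.

Definition res_to_coind (M : lmodType A) (N : lmodType S)
  (u : {linear res_mod f M -> N}) : {linear M -> coind_mod F N} :=
  lin (res_to_coind_linear u).

Fact coind_to_res_linear (M : lmodType S) (N : lmodType A)
    (u : {linear M -> res_mod f N}) :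
  linear (fun m : coind_mod F M => \sum_i x_ i *: (u (coind_at m i) : N)).
Proof.
move=> a m n; rewrite scaler_sumr.
under eq_bigr do rewrite coind_atD coind_scaleE linearD [X in _ *: X]/= scalerDr.
rewrite big_split /=; congr (_ + _).
transitivity (\sum_i \sum_j
    (x_ i * f (pi (y_ i * a * x_ j))) *: (u (coind_at m j) : N)).
  apply: eq_bigr => i _; rewrite linear_sum scaler_sumr.
  by apply: eq_bigr => j _; rewrite linearZ /= res_scaleE scalerA.
rewrite exchange_big; apply: eq_bigr => j _ /=; rewrite -scaler_suml scalerA.
congr (_ *: _); rewrite [RHS](frob_xE F).
by apply: eq_bigr => i _; rewrite mulrA.
Qed.

Definition coind_to_res (M : lmodType S) (N : lmodType A)
  (u : {linear M -> res_mod f N}) : {linear coind_mod F M -> N} :=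
  lin (coind_to_res_linear u).

(** This is [frob_yE] at 1; it recovers a map out of [res_mod f M] from its adjoint
    [res_to_coind]. *)
Lemma frob_unit (M : lmodType A) (x : M) :
  \sum_i f (pi (x_ i)) *: (y_ i *: x) = x.
Proof.
under eq_bigr do rewrite scalerA -[x_ _]mul1r.
by rewrite -scaler_suml -(frob_yE F) scale1r.
Qed.

(** The right adjoint, coinduction, preserves surjections: lift the adjoint of [g] over [A], then go
    back to [S]. *)
Lemma res_projective (P : lmodType A) :
  projective P -> projective (res_mod f P).
Proof.
move=> prP M N u g u_surj.
have [h hE] := prP _ _ _ (res_to_coind g) (coind_surj u_surj).
(* The way back is evaluation at 1: as 1 is the sum of the f (pi (x i)) * y i, this is the value
   there of the map stored as [h x]. *)
have kl : linear (fun x : res_mod f P => \sum_i pi (x_ i) *: coind_at (h x) i).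
  move=> s x y; rewrite scaler_sumr.
  under eq_bigr => i _.
    rewrite res_scaleE [h _]linearP coind_atD coind_scaleE scalerDr.
    over.
  rewrite big_split; congr (_ + _) => /=; rewrite -exchange_scale_sum.
  apply: eq_bigr => j _; rewrite scalerA; congr (_ *: _).
  rewrite -frob_piMl -[in RHS](mul1r (f s * _)) frob_piM.
  by apply: eq_bigr => i _; rewrite mul1r !mulrA.
exists (lin kl) => x /=; rewrite linear_sum -[in RHS](frob_unit x).
rewrite [RHS]linear_sum; apply: eq_bigr => i _.
rewrite linearZ -res_scaleE [RHS]linearZ /= -coind_linE hE.
by rewrite coind_atE.
Qed.

Fact coind_emb_linear (M : lmodType S) :
  linear (fun x : M => coind_of (fun i => pi (y_ i) *: x) : res_mod f _).
Proof.
move=> s x y; rewrite res_scaleE; apply: coind_atP => i.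
rewrite coind_atD coind_scaleE !coind_atE scalerDr; congr (_ + _).
under eq_bigr do rewrite coind_atE scalerA.
rewrite -scaler_suml scalerA; congr (_ *: _).
rewrite -frob_piMr -[in LHS](mulr1 (_ * _)) frob_piM.
by apply: eq_bigr => j _; rewrite mulr1.
Qed.

(* x : M is sent to the map a |-> pi (a) x. *)
Definition coind_emb (M : lmodType S) : {linear M -> res_mod f (coind_mod F M)} :=
  lin (@coind_emb_linear M).

(** By [frob_dual], the i-th summand is the family supported at [i] with value [coind_at m i]. Hence
    an [A]-linear map out of a coinduced module is determined by its composite with [coind_emb]. *)
Lemma coind_counit (M : lmodType S) (m : coind_mod F M) :
  \sum_i x_ i *: (coind_emb M (coind_at m i) : coind_mod F M) = m.
Proof.
apply: coind_atP => i; rewrite coind_at_sum -[RHS]sum_kronecker.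
apply: eq_bigr => j _; rewrite coind_scaleE.
under eq_bigr do rewrite coind_atE scalerA.
rewrite -scaler_suml -frob_dual -[in RHS](mulr1 (_ * _)) frob_piM.
by congr (_ *: _); apply: eq_bigr => k _; rewrite mulr1.
Qed.

(** The mirror image of [res_projective]: the composite of [g] with [coind_emb] is lifted over [S],
    then extended to [A] by the other adjunction. *)
Lemma coind_projective (P : lmodType S) :
  projective P -> projective (coind_mod F P).
Proof.
move=> prP M N u g u_surj.
have [v vE] := prP _ _ (res_lin f u) (res_lin f g \o coind_emb P) u_surj.
exists (coind_to_res v) => m /=; rewrite linear_sum -[in RHS](coind_counit m).
rewrite linear_sum; apply: eq_bigr => i _; rewrite !linearZ.
congr (_ *: _); exact: vE.
Qed.

Lemma res_pd_le n (M : lmodType A) : pd_le n M -> pd_le n (res_mod f M).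
Proof.
elim: n M => [|n IHn] M /=; first exact: res_projective.
move=> [P [K [i [e [prP e_surj i_inj ex pdK]]]]].
exists (res_mod f P), (res_mod f K), (res_lin f i), (res_lin f e).
by split=> //; [exact: res_projective | exact: IHn].
Qed.

Lemma coind_pd_le n (M : lmodType S) : pd_le n M -> pd_le n (coind_mod F M).
Proof.
elim: n M => [|n IHn] M /=; first exact: coind_projective.
move=> [P [K [i [e [prP e_surj i_inj ex pdK]]]]].
exists (coind_mod F P), (coind_mod F K), (coind_lin i), (coind_lin e).
split; [exact: coind_projective|exact: coind_surj|exact: coind_inj| |].
  exact: coind_exact.
exact: IHn.
Qed.

(** * Transfer of finite generation, coherence and regularity *)

Lemma res_finitely_generated (M : lmodType A) :
  finitely_generated M -> finitely_generated (res_mod f M).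
Proof.
move=> /finitely_generatedP [I [m m_span]]; apply/finitely_generatedP.
exists (I * T)%type, (fun p => y_ p.2 *: m p.1) => x.
have [c ->] := m_span x; exists (fun p => pi (c p.1 * x_ p.2)).
rewrite -(pair_bigA _ (fun i t => pi (c i * x_ t) *: (y_ t *: m i : res_mod f M))).
apply: eq_bigr => i _ /=; rewrite {1}[c i](frob_yE F) scaler_suml.
by apply: eq_bigr => t _; rewrite -scalerA.
Qed.

(* If the w generate the kernel over A of the image of m, then the pi (y i * w)
   generate the kernel of m over S. *)
Lemma coherent_matrices_descend : coherent_matrices A -> coherent_matrices S.
Proof.
move=> cohA I J m; have [K [W [W0 WP]]] := cohA I J (fun i j => f (m i j)).
exists (T * K)%type, (fun p i => pi (y_ p.1 * W p.2 i)); split=> [[t k] j|x x0].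
  transitivity (pi (y_ t * \sum_i W k i * f (m i j))).
    rewrite mulr_sumr raddf_sum; apply: eq_bigr => i _ /=.
    by rewrite mulrA frob_piMr.
  by rewrite (W0 k j) mulr0 raddf0.
have [j|a aE] := WP (fun i => f (x i)).
  transitivity (f (\sum_i x i * m i j)); last by rewrite (x0 j) rmorph0.
  by rewrite rmorph_sum; apply: eq_bigr => i _; rewrite rmorphM.
exists (fun p => pi (a p.2 * x_ p.1)) => i; rewrite -[LHS]frob_pif aE raddf_sum.
under eq_bigr do rewrite frob_piM.
rewrite exchange_big.
by rewrite -(pair_bigA _ (fun t k => pi (a k * x_ t) * pi (y_ t * W k i))).
Qed.

(** In the coordinates pi (a * x t) of the row entries, right multiplication by [m] becomes a matrix
    over [S]. Its syzygies, read as coordinates, reassemble into rows over [A], which generate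
    already with coefficients from [S]. *)
Lemma coherent_matrices_ascend : coherent_matrices S -> coherent_matrices A.
Proof.
move=> cohS I J m.
have [K [W [W0 WP]]] := cohS (I * T)%type (J * T)%type
  (fun p q => pi (y_ p.2 * m p.1 q.1 * x_ q.2)).
have sumE (a : I -> A) j u :
    \sum_p pi (a p.1 * x_ p.2) * pi (y_ p.2 * m p.1 j * x_ u) =
    pi ((\sum_i a i * m i j) * x_ u).
  rewrite -(pair_bigA _ (fun i t => pi (a i * x_ t) * pi (y_ t * m i j * x_ u))).
  rewrite mulr_suml raddf_sum; apply: eq_bigr => i _ /=.
  by rewrite -mulrA frob_piM; apply: eq_bigr => t _; rewrite !mulrA.
pose V k i := \sum_t f (W k (i, t)) * y_ t.
have piV k p : pi (V k p.1 * x_ p.2) = W k p.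
  case: p => i t /=; rewrite mulr_suml raddf_sum.
  under eq_bigr do rewrite -mulrA frob_piMl frob_dual.
  rewrite /= (bigD1 t) //= eqxx mulr1 big1 ?addr0 // => u /negPf ->.
  by rewrite mulr0.
exists K, V; split=> [k j|x x0].
  rewrite [LHS](frob_yE F) big1 // => u _.
  rewrite -sumE (eq_bigr (fun p => W k p *: (pi (y_ p.2 * m p.1 j * x_ u) : S^o))).
    by rewrite (W0 k (j, u)) rmorph0 mul0r.
  by move=> p _; rewrite piV.
have [[j u]|y yE] := WP (fun p => pi (x p.1 * x_ p.2)).
  by rewrite [LHS]sumE [X in X * _]x0 mul0r raddf0.
exists (fun k => f (y k)) => i; rewrite [LHS](frob_yE F).
under [RHS]eq_bigr do rewrite mulr_sumr.
rewrite [RHS]exchange_big; apply: eq_bigr => t _ /=.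
rewrite (yE (i, t)) rmorph_sum mulr_suml.
by apply: eq_bigr => k _; rewrite rmorphM mulrA.
Qed.

(* For a left ideal I of S this is the left ideal A I. *)
Section ExtendedIdeal.
Variable I : submodClosed S^o.

Definition ext_pred : {pred A^o} := fun a => [forall i, pi (y_ i * a) \in I].

Fact ext_pred_closed : submod_closed ext_pred.
Proof.
split=> [|a b c /forallP bI /forallP cI]; apply/forallP => i.
  by rewrite mulr0 raddf0; exact: (rpred0 I).
rewrite mulrDr raddfD; apply: (@rpredD _ I) => //; rewrite mulrA frob_piM.
by apply: (@rpred_sum _ I) => j _; exact: rpredZ.
Qed.

HB.instance Definition _ := GRing.isSubmodClosed.Build A A^o ext_pred ext_pred_closed.

Definition ext_ideal : submodClosed A^o := ext_pred.

Lemma ext_pi (a : A) : a \in ext_ideal -> pi a \in I.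
Proof.
move=> /forallP aI; rewrite -[a]mul1r frob_piM.
by apply: (@rpred_sum _ I) => i _; exact: rpredZ.
Qed.

Lemma ext_incl s : s \in I -> f s \in ext_ideal.
Proof. by move=> sI; apply/forallP => i; rewrite frob_piMr; exact: rpredZ. Qed.

(** Each coordinate pi (y i * a) lies in [I] and expands in the generators [m]; summing against [x_]
    writes [a] in the f (m k). *)
Lemma ext_finitely_generated :
  finitely_generated (ideal_module I) -> finitely_generated (ideal_module ext_ideal).
Proof.
move=> /finitely_generatedP [K [m m_span]]; apply/finitely_generatedP.
exists K, (fun k => IdealModule (ext_incl (ideal_valP (m k)))) => a.
have sp i : exists c : K -> S, pi (y_ i * ideal_val a) = \sum_k c k * ideal_val (m k).
  have /forallP/(_ i) aI := ideal_valP a.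
  have [c /(congr1 val)] := m_span (IdealModule aI).
  rewrite linear_sum => vE; exists c; rewrite [LHS]vE.
  by apply: eq_bigr => k _; rewrite linearZ.
have /fin_all_exists [c cE] := sp.
exists (fun k => \sum_i x_ i * f (c i k)); apply: val_inj.
rewrite linear_sum; under [RHS]eq_bigr do rewrite linearZ /= scaler_suml.
rewrite exchange_big /= {1}[ideal_val a](frob_xE F); apply: eq_bigr => i _.
rewrite cE rmorph_sum mulr_sumr; apply: eq_bigr => k _.
by rewrite rmorphM mulrA.
Qed.

Fact ext_unit_linear : linear (fun s : ideal_module I =>
  IdealModule (ext_incl (ideal_valP s)) : res_mod f (ideal_module ext_ideal)).
Proof. by move=> t s r; apply: val_inj; rewrite /= rmorphD rmorphM. Qed.

Fact ext_retract_linear : linear (fun a : res_mod f (ideal_module ext_ideal) =>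
  IdealModule (ext_pi (ideal_valP a)) : ideal_module I).
Proof. by move=> t a b; apply: val_inj; rewrite /= raddfD frob_piMl. Qed.

Lemma ext_unitK : cancel (lin ext_unit_linear) (lin ext_retract_linear).
Proof. by move=> s; apply: val_inj; rewrite /= frob_pif. Qed.

End ExtendedIdeal.

Lemma left_regular_coherent_descend :
  left_regular_coherent A -> left_regular_coherent S.
Proof.
move=> [/left_coherentP cohA regA]; split.
  exact/left_coherentP/coherent_matrices_descend.
move=> I /ext_finitely_generated /regA /finite_pdP [n pdJ].
apply/finite_pdP; exists n; apply: (pd_le_retract (@ext_unitK I)).
exact: res_pd_le.
Qed.

(** The universal property of the tensor product: balanced biadditive maps respect [tensor_eq], so
    identities in A ⊗_S A can be evaluated in [V]. *)
Lemma tensor_eq_sum (V : zmodType) (b : A -> A -> V) s t :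
  (forall y, {morph b^~ y : x x' / x + x'}) ->
  (forall x, {morph b x : y y' / y + y'}) ->
  (forall x c y, b (x * f c) y = b x (f c * y)) ->
  tensor_eq f s t -> \sum_(p <- s) b p.1 p.2 = \sum_(p <- t) b p.1 p.2.
Proof.
move=> bDl bDr bal.
have b0l y : b 0 y = 0 by apply: (addrI (b 0 y)); rewrite -bDl !addr0.
have b0r x : b x 0 = 0 by apply: (addrI (b x 0)); rewrite -bDr !addr0.
elim=> {s t} //.
- by move=> s t u _ -> _ ->.
- by move=> s t st; exact: perm_big.
- by move=> s s' t t' _ ss' _ tt'; rewrite !big_cat ss' tt'.
- by move=> y; rewrite big_seq1 big_nil.
- by move=> x; rewrite big_seq1 big_nil.
- by move=> x x' y; rewrite !big_cons !big_nil !addr0 bDl.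
- by move=> x y y'; rewrite !big_cons !big_nil !addr0 bDr.
by move=> x c y; rewrite !big_seq1 bal.
Qed.

(* The bimodule section of A ⊗ A -> A, tensored with M. *)
Lemma separable_retract (M : lmodType A) : separable_extension f ->
  exists (i : {linear M -> coind_mod F (res_mod f M)})
         (r : {linear coind_mod F (res_mod f M) -> M}), cancel i r.
Proof.
move=> [s [s1 sC]].
(* With coinduction identified with A ⊗_S M, this is the coordinate at [y] of a ⊗ a' x. *)
pose b y x (a a' : A) : M := f (pi (y * a)) *: (a' *: x).
have bE y x a : \sum_(p <- s) b y x p.1 (p.2 * a) = \sum_(p <- s) b y x (a * p.1) p.2.
  have := @tensor_eq_sum _ (b y x) _ _ _ _ _ (sC a).
  rewrite !big_map; apply=> [a'|a'|a' c a''] /=.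
  - by move=> c c'; rewrite /b mulrDr raddfD rmorphD scalerDl.
  - by move=> c c'; rewrite /b scalerDl scalerDr.
  by rewrite /b mulrA frob_piMr rmorphM !scalerA mulrA.
(* The section sends x to the sum of the p.1 ⊗ p.2 x; its [A]-linearity is the commutation [sC], in
   the form [bE]. *)
have ul : linear (fun x : M => coind_of
    (fun i => \sum_(p <- s) b (y_ i) x p.1 p.2 : res_mod f M)).
  move=> a x x'; apply: coind_atP => i; rewrite coind_atD coind_scaleE !coind_atE.
  transitivity (\sum_(p <- s) b (y_ i) x p.1 (p.2 * a) +
                \sum_(p <- s) b (y_ i) x' p.1 p.2).
    rewrite -big_split; apply: eq_bigr => p _.
    by rewrite /b /= !scalerDr -(scalerA p.2).
  congr (_ + _); rewrite bE.
  under [RHS]eq_bigr do rewrite coind_atE scaler_sumr.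
  rewrite [RHS]exchange_big; apply: eq_bigr => p _.
  rewrite /b mulrA frob_piM rmorph_sum scaler_suml.
  by apply: eq_bigr => j _; rewrite rmorphM -scalerA.
(* The retraction is a ⊗ x |-> a x; it returns x because the p.1 * p.2 sum to 1. *)
exists (lin ul), (coind_to_res idfun) => x /=.
under eq_bigr do rewrite coind_atE scaler_sumr.
rewrite exchange_big /= -[RHS]scale1r -s1 scaler_suml; apply: eq_bigr => p _.
under eq_bigr do rewrite /b scalerA.
by rewrite -scaler_suml -(frob_xE F) scalerA.
Qed.

Lemma left_regular_coherent_ascend : separable_extension f ->
  left_regular_coherent S -> left_regular_coherent A.
Proof.
move=> sepA rcS; have [/left_coherentP cohS _] := rcS; split.
  exact/left_coherentP/coherent_matrices_ascend.
move=> J fgJ; apply/finite_pdP.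
(* The coordinates pi (a * x t) embed [J] over [S] in a free module of finite rank. *)
have cl (i : 'I_#|T|) : linear (fun a : res_mod f (ideal_module J) =>
    pi (ideal_val a * x_ (enum_val i)) : S^o).
  by move=> s a b; rewrite /= mulrDl -mulrA raddfD frob_piMl.
have [|n pdJ] :=
  pd_finite_of_coordinates (c := fun i => lin (cl i)) rcS (res_finitely_generated fgJ).
  move=> a a0; apply: val_inj; rewrite /= [LHS](frob_yE F) big1 // => t _.
  by have /= := a0 (enum_rank t); rewrite enum_rankK => ->; rewrite rmorph0 mul0r.
have [i [r ir]] := separable_retract (ideal_module J) sepA.
by exists n; apply: pd_le_retract ir _; exact: coind_pd_le.
Qed.

End Coinduction.
(** * Skew group rings *)

Section SkewFrobenius.
Variables (gT : finGroupType) (R : pzRingType) (act : ring_action gT R).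
Variable H : {group gT}.
Local Notation RG := (skew_group_ring act).
Local Notation RH := (skew_group_ring (res_ract act H)).
Local Notation incl := (@skew_incl gT R act H).

Definition skew_proj (a : RG) : RH := [ffun h => skew_coef a (sgval h)].

Lemma skew_coef_proj a h : skew_coef (skew_proj a) h = skew_coef a (sgval h).
Proof. exact: ffunE. Qed.

Fact skew_proj_zmod_morphism : zmod_morphism skew_proj.
Proof.
by move=> a b; apply: skewP => h; rewrite skew_coefB !skew_coef_proj skew_coefB.
Qed.

HB.instance Definition _ :=
  GRing.isZmodMorphism.Build RG RH skew_proj skew_proj_zmod_morphism.

Lemma skew_coef_incl_proj a g :
  skew_coef (incl (skew_proj a)) g = if g \in H then skew_coef a g else 0.
Proof.
case: ifPn => [gH|]; last exact: skew_coef_incl_out.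
by rewrite -[g](subgK _ gH) skew_coef_incl skew_coef_proj.
Qed.

(** The coefficients of [incl s] vanish off [H], so only [k] in [H] contribute to the coefficient at
    [g], and then k^-1 g lies in [H] exactly when [g] does. *)
Lemma skew_projMl (s : RH) (a : RG) : skew_proj (incl s * a) = s * skew_proj a.
Proof.
apply: (@skew_incl_inj _ _ act); rewrite [RHS]rmorphM /=.
apply: skewP => g; rewrite skew_coef_incl_proj !skew_coefM.
case: ifPn => gH.
  apply: eq_bigr => k _; rewrite skew_coef_incl_proj.
  case: (boolP (k \in H)) => kH; first by rewrite groupM ?groupV.
  by rewrite (skew_coef_incl_out s kH) !mul0r.
rewrite big1 // => k _; rewrite skew_coef_incl_proj.
case: (boolP (k \in H)) => kH; last by rewrite (skew_coef_incl_out s kH) mul0r.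
by rewrite groupMl ?groupV // (negPf gH) rmorph0 mulr0.
Qed.

Lemma skew_projMr (a : RG) (s : RH) : skew_proj (a * incl s) = skew_proj a * s.
Proof.
apply: (@skew_incl_inj _ _ act); rewrite [RHS]rmorphM /=.
apply: skewP => g; rewrite skew_coef_incl_proj !skew_coefM.
have out k : k \in H -> g \notin H -> skew_coef (incl s) (k^-1 * g)%g = 0.
  by move=> kH gH; apply: skew_coef_incl_out; rewrite groupMl ?groupV.
case: ifPn => gH.
  apply: eq_bigr => k _; rewrite skew_coef_incl_proj; case: ifPn => // kH.
  rewrite (skew_coef_incl_out s) ?rmorph0 ?mulr0 //.
  by rewrite groupMr ?groupV.
rewrite big1 // => k _; rewrite skew_coef_incl_proj; case: ifPn => kH.
  by rewrite out // rmorph0 mulr0.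
by rewrite mul0r.
Qed.

Lemma skew_coef_monoMl (a : RG) g k :
  skew_coef (skew_mono act 1 g * a) k = act g (skew_coef a (g^-1 * k)%g).
Proof.
rewrite skew_coefM (bigD1 g) //= big1 => [|l /negPf lg].
  by rewrite skew_coef_mono eqxx mul1r addr0.
by rewrite skew_coef_mono lg mul0r.
Qed.

Lemma skew_coef_monoMr (a : RG) g k :
  skew_coef (a * skew_mono act 1 g) k = skew_coef a (k * g^-1)%g.
Proof.
rewrite skew_coefM (bigD1 (k * g^-1)%g) //= big1 => [|l lg].
  rewrite skew_coef_mono invMg invgK -mulgA mulVg mulg1 eqxx.
  by rewrite rmorph1 mulr1 addr0.
rewrite skew_coef_mono -(can_eq (mulKg l)) mulKVg; case: eqP => [kE|].
  by rewrite kE mulgK eqxx in lg.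
by rewrite rmorph0 mulr0.
Qed.

Lemma skew_proj1 : skew_proj 1 = 1.
Proof.
apply: skewP => h; rewrite skew_coef_proj !skew_coef_mono.
by rewrite -(inj_eq val_inj).
Qed.

(** The right cosets of [H], each given by its canonical representative; as a subtype of [gT] this
    is a finite index type for the bases. *)
Definition transversal_elt := {g : gT | (repr (H :* g) == g)%g}.

Lemma transversal_eltP g (t : transversal_elt) :
  (g * (val t)^-1 \in H)%g = (val t == repr (H :* g)%g).
Proof.
case: t => t /= /eqP tE; rewrite -mem_rcoset.
apply/idP/eqP => [|->]; last by rewrite rcoset_sym mem_repr_rcoset.
by move=> /rcoset_eqP ->; rewrite tE.
Qed.

Fact repr_transversal g : (repr (H :* repr (H :* g)) == repr (H :* g))%g.
Proof. by rewrite rcoset_repr. Qed.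

Definition coset_rep g : transversal_elt :=
  exist (fun h => is_true (repr (H :* h) == h)%g) _ (repr_transversal g).

(** Each [g] lies in exactly one coset H t, so a single term survives. *)
Lemma sum_transversal (V : nmodType) g (F : transversal_elt -> V) :
  (\sum_t if (g * (val t)^-1 \in H)%g then F t else 0) = F (coset_rep g).
Proof.
rewrite (bigD1 (coset_rep g)) // transversal_eltP eqxx big1 => [|t tg].
  exact: addr0.
by rewrite transversal_eltP; case: eqP => // tE; case/eqP: tg; exact: val_inj.
Qed.

Definition skew_x (t : transversal_elt) : RG := skew_mono act 1 (val t)^-1%g.
Definition skew_y (t : transversal_elt) : RG := skew_mono act 1 (val t).

(** The term at [t] is the part of [a] supported on the left coset t^-1 H, and these cosets
    partition the group. *)
Lemma skew_xE a : a = \sum_t skew_x t * incl (skew_proj (skew_y t * a)).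
Proof.
apply: skewP => g; rewrite skew_coef_sum.
(* g lies in t^-1 H exactly when g^-1 lies in H t, so [sum_transversal] is applied at g^-1. *)
transitivity (\sum_t if (g^-1 * (val (t : transversal_elt))^-1 \in H)%g
                     then skew_coef a g else 0).
  by rewrite (sum_transversal _ (fun=> skew_coef a g)).
apply: eq_bigr => t _; rewrite skew_coef_monoMl skew_coef_incl_proj.
rewrite -invMg groupV invgK; case: ifP => _; last by rewrite rmorph0.
by rewrite skew_coef_monoMl mulKg ract_invl.
Qed.

Lemma skew_yE a : a = \sum_t incl (skew_proj (a * skew_x t)) * skew_y t.
Proof.
apply: skewP => g; rewrite skew_coef_sum.
transitivity (\sum_t if (g * (val (t : transversal_elt))^-1 \in H)%g
                     then skew_coef a g else 0).
  by rewrite (sum_transversal _ (fun=> skew_coef a g)).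
apply: eq_bigr => t _; rewrite skew_coef_monoMr skew_coef_incl_proj.
by case: ifP => // _; rewrite skew_coef_monoMr invgK mulgKV.
Qed.

(** The product is the group element t u^-1, which lies in [H] only if H t = H u, that is t = u,
    both being canonical representatives. *)
Lemma skew_dual t u : skew_proj (skew_y t * skew_x u) = (t == u)%:R.
Proof.
rewrite skew_monoM rmorph1 mulr1.
case: eqP => [->|tu]; first by rewrite mulgV -skew_proj1.
apply: (@skew_incl_inj _ _ act); rewrite rmorph0.
apply: skewP => g; rewrite skew_coef_incl_proj skew_coef_mono.
have -> : skew_coef (0 : RG) g = 0 by exact: ffunE.
case: ifP => // gH; case: eqP => // gE; case: tu; apply: val_inj.
move: gH; rewrite gE transversal_eltP => /eqP ->.
by case: t {gE} => t /= /eqP.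
Qed.

Definition skew_frobenius : frobenius incl :=
  Frobenius skew_projMl skew_projMr skew_proj1 skew_xE skew_yE skew_dual.

End SkewFrobenius.

Theorem proposition3p7 (R : pzRingType) (gT : finGroupType)
  (act : ring_action gT R) (H : {group gT}) :
  (left_regular_coherent (skew_group_ring act) ->
   left_regular_coherent (skew_group_ring (res_ract act H))) /\
  (separable_extension (@skew_incl gT R act H) ->
   (left_regular_coherent (skew_group_ring act) <->
    left_regular_coherent (skew_group_ring (res_ract act H)))).
Proof.
have F := skew_frobenius act H; split; first exact: left_regular_coherent_descend F.
move=> sep; split; first exact: left_regular_coherent_descend F.
exact: left_regular_coherent_ascend F sep.
Qed.
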